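(* Let $\mathcal{C}$ be a clutter with vertex set $\{x_1,\ldots,x_n\}$ and let $I=I(\mathcal{C})$ be its edge ideal. If $\ell_k=(a_k,-d_k)$, with $a_k\in\mathbb{N}^n$ and $d_k\in\mathbb{N}$, is any of the vectors $\ell_1,\ldots,\ell_r$ occurring in the irreducible representation of the Rees cone $\mathbb{R}_+(I)$, then $a_k$ is an irreducible $d_k$-cover of $\mathcal{C}$.
   Context: $\mathbb{N}=\{0,1,2,\ldots\}$. A clutter $\mathcal{C}$ with vertex set $\{x_1,\ldots,x_n\}$ is a family of subsets (edges) of the vertex set, none of which is included in another. Let $v_1,\ldots,v_q\in\{0,1\}^n$ be the incidence vectors of the edges of $\mathcal{C}$; the edge ideal $I(\mathcal{C})$ is generated by the monomials $x^{v_1},\ldots,x^{v_q}$. The Rees cone $\mathbb{R}_+(I)\subset\mathbb{R}^{n+1}$ is the cone of nonnegative real combinations of $e_1,\ldots,e_n,(v_1,1),\ldots,(v_q,1)$; it has dimension $n+1$. Its irreducible representation is written $$\mathbb{R}_+(I)=H_{e_1}^+\cap\cdots\cap H_{e_{n+1}}^+\cap H_{\ell_1}^+\cap\cdots\cap H_{\ell_r}^+,$$ where $H_c^+=\{y\in\mathbb{R}^{n+1}\mid\langle y,c\rangle\geq 0\}$ and each $\ell_k\in\mathbb{Z}^{n+1}$ has relatively prime nonzero entries; here $\ell_1,\ldots,\ell_r$ are the primitive integral inner normal vectors of the facets of $\mathbb{R}_+(I)$ that do not lie in a coordinate hyperplane. Each $\ell_k$ has the form $(a_k,-d_k)$ with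 $a_k\in\mathbb{N}^n$, $d_k\in\mathbb{N}$. For $0\neq a\in\mathbb{N}^n$ and $b\in\mathbb{N}$, $a$ is a $b$-cover of $\mathcal{C}$ if $\langle v_i,a\rangle\geq b$ for $i=1,\ldots,q$. A $b$-cover $a$ is reducible if there are an $i$-cover $c$ and a $j$-cover $d$ of $\mathcal{C}$ (with $i,j\in\mathbb{N}$; covers are nonzero vectors by definition) such that $a=c+d$ and $b=i+j$; otherwise it is irreducible. *)

(* Defs.v *)
From HB Require Import structures.
From mathcomp Require Import all_boot all_order all_algebra.
From mathcomp Require Import classical_sets reals.

Set Implicit Arguments.
Unset Strict Implicit.
Unset Printing Implicit Defensive.

Import Order.TTheory GRing.Theory Num.Theory.
Local Open Scope classical_set_scope.
Local Open Scope ring_scope.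

(* A clutter on the vertices x_0, ..., x_(n-1) is given by its set of edges. *)
Definition clutter n (E : {set {set 'I_n}}) : Prop :=
  forall A B : {set 'I_n}, A \in E -> B \in E -> A \subset B -> A = B.

Definition dotv (S : pzSemiRingType) m (u v : 'rV[S]_m) : S :=
  \sum_i u 0 i * v 0 i.

Definition incidence (S : pzSemiRingType) n (A : {set 'I_n}) : 'rV[S]_n :=
  \row_i (i \in A)%:R.

Definition is_cover n (E : {set {set 'I_n}}) (b : nat) (a : 'rV[nat]_n) : Prop :=
  a != 0 /\ forall A, A \in E -> (b <= dotv (incidence nat A) a)%N.

Definition reducible_cover n (E : {set {set 'I_n}}) (b : nat) (a : 'rV[nat]_n)
    : Prop :=
  exists (i j : nat) (c d : 'rV[nat]_n),
    [/\ is_cover E i c, is_cover E j d, a = c + d & b = (i + j)%N].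

Definition irreducible_cover n (E : {set {set 'I_n}}) (b : nat)
    (a : 'rV[nat]_n) : Prop :=
  is_cover E b a /\ ~ reducible_cover E b a.

Definition hyperplane (R : realType) m (c : 'rV[R]_m) : set 'rV[R]_m :=
  [set y | dotv y c = 0].

Definition halfspace (R : realType) m (c : 'rV[R]_m) : set 'rV[R]_m :=
  [set y | 0 <= dotv y c].

(* The dimension of a cone P is that of its linear span (which is its affine
   hull, since 0 is in P): the rows of B form a basis of the span of P chosen
   inside P. *)
Definition has_dim (R : realType) m (P : set 'rV[R]_m) (d : nat) : Prop :=
  exists B : 'M[R]_(d, m),
    [/\ row_free B, forall i, P (row i B) & forall y, P y -> (y <= B)%MS].

Definition is_facet (R : realType) m (P F : set 'rV[R]_m) : Prop :=
  (exists c : 'rV[R]_m, P `<=` halfspace c /\ F = P `&` hyperplane c) /\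
  (exists d : nat, has_dim P d.+1 /\ has_dim F d).

Definition inner_normal (R : realType) m (P F : set 'rV[R]_m) (c : 'rV[R]_m)
    : Prop :=
  [/\ c != 0, P `<=` halfspace c & F = P `&` hyperplane c].

(* Zero entries do not affect the gcd. *)
Definition primitive m (l : 'rV[int]_m) : Prop :=
  \big[gcdn/0%N]_i absz (l 0 i) = 1%N.

Definition in_coordinate_hyperplane (R : realType) m (F : set 'rV[R]_m) : Prop :=
  exists i : 'I_m, F `<=` hyperplane (delta_mx 0 i).

Definition rees_cone (R : realType) n (E : {set {set 'I_n}})
    : set 'rV[R]_(n + 1) :=
  [set y | exists (s : 'I_n -> R) (t : {set 'I_n} -> R),
    [/\ forall i, 0 <= s i, forall A, 0 <= t A &
        y = \sum_i s i *: row_mx (delta_mx 0 i) 0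
            + \sum_(A in E) t A *: row_mx (incidence R A) (const_mx 1)]].

Arguments rees_cone R {n} E _.

Definition realv (R : realType) m (l : 'rV[int]_m) : 'rV[R]_m :=
  map_mx intr l.

Definition rees_normal (R : realType) n (E : {set {set 'I_n}})
    (l : 'rV[int]_(n + 1)) : Prop :=
  primitive l /\
  exists F : set 'rV[R]_(n + 1),
    [/\ is_facet (rees_cone R E) F, inner_normal (rees_cone R E) F (realv R l)
      & ~ in_coordinate_hyperplane F].

(* The half-spaces of the e_i always belong to the representation, although the
   i-th one is redundant when the vertex x_i (i < n) lies in every edge. *)
Record irreducible_representation (R : realType) n (E : {set {set 'I_n}})
    r (l : 'I_r -> 'rV[int]_(n + 1)) : Prop := IrreducibleRepresentation {
  irr_rep_eq : rees_cone R E =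
    (\bigcap_(i in [set: 'I_(n + 1)]) halfspace (delta_mx 0 i)) `&`
    (\bigcap_(k in [set: 'I_r]) halfspace (realv R (l k)));
  irr_rep_inj : injective l;
  irr_rep_normal :
    forall c : 'rV[int]_(n + 1), (exists k, l k = c) <-> rees_normal R E c
}.

Definition cover_normal n (a : 'rV[nat]_n) (d : nat) : 'rV[int]_(n + 1) :=
  row_mx (map_mx Posz a) (const_mx (- d%:Z)).

(* Main.v *)
Require Import Defs.
From HB Require Import structures.
From mathcomp Require Import all_boot all_order all_algebra.
From mathcomp Require Import classical_sets reals.

Import Order.TTheory GRing.Theory Num.Theory.
Local Open Scope ring_scope.

(** If [a = c + c'] is a reduction with [d = i + j], then [(a, -d)] is the sum
    of [(c, -i)] and [(c', -j)], both nonnegative on the Rees cone, so both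
    vanish on the facet cut out by [(a, -d)].  The cone is full-dimensional
    (otherwise there are no edges and it lies in a coordinate hyperplane), so
    normals to the facet form a line and the two summands are proportional to
    [(a, -d)], with integer nonnegative factors since that vector is primitive.
    The factors add up to 1, so one of [c] and [c'] is zero. *)

Lemma dotvE (R : realType) m (u v : 'rV[R]_m) : dotv u v = (u *m v^T) 0 0.
Proof. by rewrite mxE; apply: eq_bigr => i _; rewrite mxE. Qed.

Lemma dotvDl (R : realType) m (u v w : 'rV[R]_m) :
  dotv (u + v) w = dotv u w + dotv v w.
Proof. by rewrite !dotvE mulmxDl mxE. Qed.

Lemma dotvDr (R : realType) m (u v w : 'rV[R]_m) :
  dotv u (v + w) = dotv u v + dotv u w.
Proof. by rewrite !dotvE linearD mulmxDr mxE. Qed.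

Lemma dotvZl (R : realType) m (x : R) (u v : 'rV[R]_m) :
  dotv (x *: u) v = x * dotv u v.
Proof. by rewrite !dotvE -scalemxAl mxE. Qed.

Lemma dotv_suml (R : realType) m (I : finType) (P : pred I)
    (F : I -> 'rV[R]_m) v :
  dotv (\sum_(i | P i) F i) v = \sum_(i | P i) dotv (F i) v.
Proof.
by rewrite dotvE mulmx_suml summxE; apply: eq_bigr => i _; rewrite dotvE.
Qed.

Lemma dotv_delta (R : realType) m (i : 'I_m) (v : 'rV[R]_m) :
  dotv (delta_mx 0 i) v = v 0 i.
Proof. by rewrite dotvE -rowE !mxE. Qed.

Lemma row_mx_delta (R : realType) n (i : 'I_n) :
  row_mx (delta_mx 0 i) 0 = delta_mx 0 (lshift 1 i) :> 'rV[R]_(n + 1).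
Proof.
apply/rowP => j; rewrite !mxE.
by case: splitP => k jk; rewrite !mxE // -!val_eqE /= jk // gtn_eqF // ltn_addr.
Qed.

Lemma rees_cone_vertex (R : realType) n (E : {set {set 'I_n}}) (i : 'I_n) :
  rees_cone R E (row_mx (delta_mx 0 i) 0).
Proof.
exists (fun j => (j == i)%:R), (fun=> 0); split=> [j|A|] //.
rewrite [X in _ + X]big1 ?addr0; last by move=> A _; rewrite scale0r.
rewrite (bigD1 i) //= eqxx scale1r big1 ?addr0 // => j /negPf ->.
by rewrite scale0r.
Qed.

Lemma rees_cone_edge (R : realType) n (E : {set {set 'I_n}}) (A : {set 'I_n}) :
  A \in E -> rees_cone R E (row_mx (incidence R A) (const_mx 1)).
Proof.
move=> AE; exists (fun=> 0), (fun B => (B == A)%:R); split=> [j|B|] //.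
rewrite [X in X + _]big1 ?add0r; last by move=> i _; rewrite scale0r.
rewrite (bigD1 A) //= eqxx scale1r big1 ?addr0 // => B /andP[_ /negPf ->].
by rewrite scale0r.
Qed.

Lemma rees_cone_halfspace (R : realType) n (E : {set {set 'I_n}})
    (c : 'rV[R]_(n + 1)) :
  (forall i : 'I_n, 0 <= c 0 (lshift 1 i)) ->
  (forall A, A \in E -> 0 <= dotv (row_mx (incidence R A) (const_mx 1)) c) ->
  (rees_cone R E `<=` halfspace c)%classic.
Proof.
move=> c_ge0 cE y [s [t [s_ge0 t_ge0 ->]]]; rewrite /halfspace /=.
rewrite dotvDl !dotv_suml addr_ge0 // sumr_ge0 // => [i _|A AE].
  by rewrite dotvZl row_mx_delta dotv_delta mulr_ge0.
by rewrite dotvZl mulr_ge0 // cE.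
Qed.

Lemma cover_normal_vertex (R : realType) n (a : 'rV[nat]_n) d (i : 'I_n) :
  realv R (cover_normal a d) 0 (lshift 1 i) = (a 0 i)%:R.
Proof. by rewrite mxE row_mxEl mxE. Qed.

Lemma cover_normal_last (R : realType) n (a : 'rV[nat]_n) d (i : 'I_1) :
  realv R (cover_normal a d) 0 (rshift n i) = - d%:R.
Proof. by rewrite mxE row_mxEr mxE rmorphN. Qed.

(** The value is the slack of the cover inequality at [A], so nonnegativity on the edge generators
    of the cone is the cover condition. *)
Lemma dotv_cover_normal_edge (R : realType) n (a : 'rV[nat]_n) d
    (A : {set 'I_n}) :
  dotv (row_mx (incidence R A) (const_mx 1)) (realv R (cover_normal a d))
  = (dotv (incidence nat A) a)%:R - d%:R.
Proof.
rewrite /dotv big_split_ord big_ord1 row_mxEr mxE mul1r cover_normal_last.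
congr (_ - _).
rewrite natr_sum; apply: eq_bigr => i _.
by rewrite row_mxEl cover_normal_vertex !mxE natrM natn.
Qed.

Lemma cover_normal_halfspace (R : realType) n (E : {set {set 'I_n}})
    (a : 'rV[nat]_n) d :
  is_cover E d a ->
  (rees_cone R E `<=` halfspace (realv R (cover_normal a d)))%classic.
Proof.
case=> _ aE; apply: rees_cone_halfspace => [i|A AE].
  by rewrite cover_normal_vertex.
by rewrite dotv_cover_normal_edge subr_ge0 ler_nat aE.
Qed.

Lemma cover_normalD n (a c : 'rV[nat]_n) d e :
  cover_normal (a + c) (d + e) = cover_normal a d + cover_normal c e.
Proof.
rewrite /cover_normal add_row_mx; congr row_mx.
  by apply/rowP => i; rewrite !mxE.
by apply/rowP => i; rewrite !mxE PoszD opprD.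
Qed.

(** The cokernel [K] of a basis [B] kills the whole cone. The vertex generators force all rows of
    [K] but the last to vanish, and then a single edge forces the last one, so [B] has full rank. *)
Lemma rees_cone_dim (R : realType) n (E : {set {set 'I_n}}) d :
  E != finset.set0 -> has_dim (rees_cone R E) d -> d = (n + 1)%N.
Proof.
case/set0Pn => A AE [B [/eqP rB _ PB]]; rewrite -rB; apply/eqP.
suff: row_full B by [].
rewrite -sub1mx submxE mul1mx; set K := cokermx B.
have PK y : rees_cone R E y -> y *m K = 0.
  by move=> /PB; rewrite submxE => /eqP.
have Ku : usubmx K = 0.
  apply/row_matrixP => i; rewrite row0 -(PK _ (rees_cone_vertex _ _ E i)).
  by rewrite -{2}(vsubmxK K) mul_row_col mul0mx addr0 -rowE.
have := PK _ (rees_cone_edge _ _ _ _ AE).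
rewrite -(vsubmxK K) mul_row_col Ku mulmx0 add0r => Kd.
rewrite -(_ : 0 = dsubmx K) ?col_mx0 // -Kd.
by rewrite (_ : const_mx 1 = 1%:M) ?mul1mx //; apply/rowP => i; rewrite !mxE !ord1.
Qed.

(** The orthogonal complement of [m] independent rows in dimension [m + 1] is a line, spanned by
    [v]. Cross products avoid a scalar in [F], so the identity can later be pulled back to the
    integers. *)
Lemma orthogonal_proportional (F : fieldType) m (B : 'M[F]_(m, m + 1))
    (u v : 'rV[F]_(m + 1)) i j :
  row_free B -> B *m u^T = 0 -> B *m v^T = 0 -> v != 0 ->
  u 0 i * v 0 j = u 0 j * v 0 i.
Proof.
move=> /eqP rB Bu Bv v0.
have kerP (w : 'rV_(m + 1)) : B *m w^T = 0 -> (w <= kermx B^T)%MS.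
  by move=> Bw; apply/sub_kermxP; rewrite -[LHS]trmxK trmx_mul trmxK Bw trmx0.
have vK : (kermx B^T <= v)%MS.
  have [_ <-] := mxrank_leqif_sup (kerP _ Bv).
  by rewrite mxrank_ker mxrank_tr rB addKn rank_rV v0.
have /sub_rVP[x ->] := submx_trans (kerP _ Bu) vK.
by rewrite !mxE mulrAC.
Qed.

(** Since the entries of [l] have gcd 1, [w 0 j] is up to sign the gcd of the products
    [w 0 j * l 0 i], each of which is a multiple of [l 0 j]. *)
Lemma primitive_dvd m (l w : 'rV[int]_m) j :
  primitive l -> (forall i, w 0 j * l 0 i = w 0 i * l 0 j) ->
  (absz (l 0%R j) %| absz (w 0%R j))%N.
Proof.
move=> prim_l wl; rewrite -[absz (w 0 j)]muln1 -[X in (_ * X)%N]prim_l.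
rewrite (big_endo (muln (absz (w 0 j)))) ?muln0 //; last first.
  by move=> x y; rewrite muln_gcdr.
by apply/dvdn_biggcdP => i _; rewrite -abszM wl abszM dvdn_mull.
Qed.

Theorem lemma2p8 (R : realType) (n : nat) (E : {set {set 'I_n}})
    (clutterE : clutter E)
    (r : nat) (l : 'I_r -> 'rV[int]_(n + 1))
    (irr_l : irreducible_representation R E l)
    (k : 'I_r) (a : 'rV[nat]_n) (d : nat) (l_k : l k = cover_normal a d) :
  irreducible_cover E d a.
Proof.
have [_ _ /(_ (l k))[/(_ (ex_intro _ k erefl))]] := irr_l.
rewrite l_k => -[prim_l [F [[_ [m [dimP [B [freeB FB _]]]]] [l0 Pl FE] nF]]] _.
have FP y : F y -> rees_cone R E y by rewrite FE => -[].
have Fl y : F y -> dotv y (realv R (cover_normal a d)) = 0.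
  by rewrite FE => -[].
have E0 : E != finset.set0.
  (* Without edges, the last coordinate vanishes on the whole cone. *)
  apply/eqP => E0; apply: nF; exists (rshift n 0) => y /FP[s [t [_ _ ->]]].
  rewrite /hyperplane /= E0 big_set0 addr0 dotv_suml big1 // => i _.
  rewrite dotvZl row_mx_delta dotvE trmx_delta -colE !mxE.
  by rewrite eq_rlshift andbF mulr0.
(* The cone has dimension [m.+1], so the rows of [B] are [n] independent vectors of [F] in dimension
   [n + 1]. *)
have /eqP := rees_cone_dim _ _ _ _ E0 dimP; rewrite addn1 eqSS => /eqP m_n.
subst m.
have a0 : a != 0.
  (* If [a = 0], the normal is a nonzero multiple of the last coordinate vector, which puts [F] in a
     coordinate hyperplane. *)
  apply/eqP => a0; have l_vertex i :
      realv R (cover_normal a d) 0 (lshift 1 i) = 0.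
    by rewrite cover_normal_vertex a0 mxE.
  have d0 : d%:R != 0 :> R.
    apply: contraNneq l0 => d0; apply/eqP/rowP => i; rewrite [RHS]mxE.
    by case: (split_ordP i) => j ->; rewrite // cover_normal_last d0 oppr0.
  apply: nF; exists (rshift n 0) => y /Fl.
  rewrite /hyperplane /= {1}/dotv big_split_ord /= big_ord1 cover_normal_last.
  rewrite [X in X + _]big1 => [|i _]; last by rewrite l_vertex mulr0.
  move/eqP; rewrite add0r mulrN oppr_eq0 mulf_eq0 (negPf d0) orbF => /eqP y0.
  by rewrite dotvE trmx_delta -colE mxE.
split.
  split=> // A AE; rewrite -(ler_nat R) -subr_ge0 -dotv_cover_normal_edge.
  exact/Pl/rees_cone_edge.
move=> [i [j [c [c' [cov_c cov_c' a_cc' d_ij]]]]].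
set w := realv R (cover_normal c i); set w' := realv R (cover_normal c' j).
have lw : realv R (cover_normal a d) = w + w'.
  by rewrite a_cc' d_ij cover_normalD /realv map_mxD.
have Fw y : F y -> dotv y w = 0.
  (* Both summands are nonnegative on the cone and their sum vanishes on [F]. *)
  move=> Fy; have := Fl y Fy; rewrite lw dotvDr => /eqP.
  rewrite paddr_eq0; first by case/andP => /eqP.
    exact: (cover_normal_halfspace _ _ _ _ _ cov_c _ (FP y Fy)).
  exact: (cover_normal_halfspace _ _ _ _ _ cov_c' _ (FP y Fy)).
have Bker v : (forall y, F y -> dotv y v = 0) -> B *m v^T = 0.
  move=> Fv; apply/row_matrixP => p; rewrite row_mul row0.
  by apply/matrixP => x y; rewrite !ord1 -dotvE Fv // mxE.
have wl p q : cover_normal c i 0 p * cover_normal a d 0 q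
              = cover_normal c i 0 q * cover_normal a d 0 p.
  apply: (@intr_inj R); rewrite !intrM.
  have := orthogonal_proportional _ _ _ _ _ p q freeB (Bker _ Fw) (Bker _ Fl) l0.
  by rewrite !mxE.
have [c_neq0 _] := cov_c; have [/eqP c'_neq0 _] := cov_c'; apply: c'_neq0.
have /rV0Pn[p cp] := c_neq0.
have a_sum q : a 0 q = (c 0%R q + c' 0%R q)%N by rewrite a_cc' mxE.
have wlE q : (c 0%R p * a 0%R q = c 0%R q * a 0%R p)%N.
  by have := wl (lshift 1 p) (lshift 1 q); rewrite !row_mxEl !mxE -!PoszM => -[].
(* Here [a 0 p] divides the nonzero [c 0 p], so [c 0 p + c' 0 p <= c 0 p] and [c' 0 p = 0]. *)
have := primitive_dvd _ _ _ _ prim_l (fun q => wl (lshift 1 p) q).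
rewrite !row_mxEl !mxE /= => /dvdn_leq -/(_ _)/[!lt0n]/(_ cp).
rewrite a_sum -{2}[c 0 p]addn0 leq_add2l leqn0 => /eqP c'p.
apply/rowP => q; rewrite mxE; apply/eqP.
(* Now [a 0 p = c 0 p], so the factor between [c] and [a] is 1; cancelling it gives [a 0 q = c 0 q]
   for every [q], whence [c' = 0], which no cover can be. *)
have /eqP := wlE q; rewrite (a_sum p) c'p addn0 mulnC eqn_pmul2r ?lt0n //.
by rewrite a_sum -{2}[c 0 q]addn0 eqn_add2l.
Qed.
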